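(* Let $d\geq 2$, let $G\leq\mathrm{Aut}(\mathcal{T}_d)$ be a self-similar group, and let $V_dG$ be the associated Röver–Nekrashevych group acting on $\mathfrak{C}_d$. Then $V_dG$ acts oligomorphically on each of its orbits in $\mathfrak{C}_d$; that is, for every orbit $S\subseteq\mathfrak{C}_d$ of $V_dG$ and every $n\geq 1$, the induced (diagonal) action of $V_dG$ on $S^n$ has finitely many orbits.
   Context: For $d\geq 2$, let $X_d=\{0,\ldots,d-1\}$, let $X_d^*$ be the set of finite words over $X_d$ (including the empty word), and let $\mathcal{T}_d$ be the infinite rooted $d$-ary tree whose nodes are the elements of $X_d^*$. If $g\in \mathrm{Aut}(\mathcal{T}_d)$ (rooted tree automorphisms) and $\alpha\in X_d^*$, the local action of $g$ at $\alpha$ is the unique $g|_\alpha\in \mathrm{Aut}(\mathcal{T}_d)$ such that $g(\alpha\cdot\beta)=g(\alpha)\cdot g|_\alpha(\beta)$ for every $\beta\in X_d^*$, where $\cdot$ denotes concatenation. A group $G\leq\mathrm{Aut}(\mathcal{T}_d)$ is self-similar if $g|_\alpha\in G$ for all $g\in G$ and $\alpha\in X_d^*$. Let $\mathfrak{C}_d=X_d^\omega$ be the Cantor space of infinite words over $X_d$ (product topology); $\mathrm{Aut}(\mathcal{T}_d)$ acts faithfully on $\mathfrak{C}_d$ by homeomorphisms, and its elements are identified with the corresponding homeomorphisms. For $\alpha\in X_d^*$, the cone $\alpha\mathfrak{C}_d$ is the set of all infinite words having $\alpha$ as a prefix. If $h\in\mathrm{Homeo}(\mathfrak{C}_d)$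 maps a cone $\alpha\mathfrak{C}_d$ onto a cone $\beta\mathfrak{C}_d$, the local action $h|_\alpha$ is the homeomorphism of $\mathfrak{C}_d$ defined by $h(\alpha\cdot\psi)=\beta\cdot h|_\alpha(\psi)$ for all $\psi\in X_d^\omega$. For a self-similar group $G$, the Röver–Nekrashevych group $V_dG$ is the group of all $h\in\mathrm{Homeo}(\mathfrak{C}_d)$ such that for every $p\in\mathfrak{C}_d$ there exists a cone $\alpha\mathfrak{C}_d$ containing $p$ such that $h(\alpha\mathfrak{C}_d)$ is a cone and $h|_\alpha\in G$. *)

(* Defs.v *)
From HB Require Import structures.
From mathcomp Require Import all_boot.
From mathcomp Require Import boolp classical_sets functions cardinality topology.
Set Implicit Arguments.
Unset Strict Implicit.
Unset Printing Implicit Defensive.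
Local Open Scope classical_set_scope.

Section PermutationGroups.
Variable T : Type.
Implicit Types (F : set (T -> T)) (S : set T).

Definition perm_group F :=
  [/\ (forall f, F f -> bijective f), F id,
      (forall f g, F f -> F g -> F (f \o g)) &
      (forall f g, F f -> cancel f g -> cancel g f -> F g)].

Definition orbit_of F (p : T) : set T := [set f p | f in F].

Definition diag_orbit F n (t : 'I_n -> T) : set ('I_n -> T) :=
  [set f \o t | f in F].

Definition oligomorphic F S :=
  forall n, (0 < n)%N ->
    finite_set [set diag_orbit F t | t in [set t : 'I_n -> T | forall i, S (t i)]].

End PermutationGroups.

Section Tree.
Variable d : nat.
Implicit Types (a b c : seq 'I_d) (g : seq 'I_d -> seq 'I_d).

Definition child a b := exists x : 'I_d, b = rcons a x.

Definition adjacent a b := child a b \/ child b a.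

Definition tree_aut : set (seq 'I_d -> seq 'I_d) :=
  [set g | [/\ bijective g, g [::] = [::] &
               forall a b, adjacent (g a) (g b) <-> adjacent a b]].

(* For a tree automorphism g this is the only solution of
   g (a ++ b) = g a ++ local_action g a b, see local_actionE. *)
Definition local_action g a : seq 'I_d -> seq 'I_d :=
  fun b => drop (size a) (g (a ++ b)).

Definition self_similar (G : set (seq 'I_d -> seq 'I_d)) :=
  forall g a, G g -> G (local_action g a).

Lemma tree_aut_child g a b : tree_aut g -> child a b -> child (g a) (g b).
Proof.
move=> [/bij_inj ginj g0 gadj].
elim/last_ind: a b => [|c y IHc] b [x ->].
  have /gadj : adjacent [::] (rcons [::] x) by left; exists x.
  rewrite g0 => -[//|[z /(congr1 size)]]; by rewrite size_rcons.
have /gadj [//|[z gz]] : adjacent (rcons c y) (rcons (rcons c y) x).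
  by left; exists x.
have [|w gw] := IHc (rcons c y); first by exists y.
move: gw; rewrite gz => /rcons_inj[/ginj /(congr1 size)].
by rewrite !size_rcons => /eqP; rewrite -addn2 -{2}[size c]addn0 eqn_add2l.
Qed.

Lemma tree_aut_size g a : tree_aut g -> size (g a) = size a.
Proof.
move=> gA; elim/last_ind: a => [|a x IHa]; first by have [_ ->] := gA.
have [|y ->] := @tree_aut_child g a (rcons a x) gA; first by exists x.
by rewrite !size_rcons IHa.
Qed.

Lemma local_actionE g a b : tree_aut g -> g (a ++ b) = g a ++ local_action g a b.
Proof.
move=> gA; rewrite -{1}(cat_take_drop (size a) (g (a ++ b))); congr (_ ++ _).
elim/last_ind: b => [|b x IHb].
  by rewrite cats0 -(tree_aut_size a gA) take_size.
have [|y] := @tree_aut_child g (a ++ b) (a ++ rcons b x) gA.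
  by exists x; rewrite rcons_cat.
move=> ->; rewrite -IHb -cats1 takel_cat //.
by rewrite (tree_aut_size _ gA) size_cat leq_addr.
Qed.

Lemma local_action_aut g a : tree_aut g -> tree_aut (local_action g a).
Proof.
move=> gA; have [gbij g0 gadj] := gA.
have adj_cat u v w : adjacent (u ++ v) (u ++ w) <-> adjacent v w.
  have child_cat b c : child (u ++ b) (u ++ c) <-> child b c.
    split=> -[x e]; exists x; last by rewrite e rcons_cat.
    by move/eqP: e; rewrite rcons_cat eqseq_cat// eqxx => /eqP.
  by rewrite /adjacent !child_cat.
split.
- have [g' gK g'K] := gbij.
  have sz' c : size (g' c) = size c.
    by rewrite -[in RHS](g'K c) (tree_aut_size _ gA).
  pose l' b := drop (size a) (g' (g a ++ b)).
  have l'E b : g' (g a ++ b) = a ++ l' b.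
    rewrite -{1}(cat_take_drop (size a) (g' (g a ++ b))); congr (_ ++ _).
    apply: (bij_inj gbij).
    have := local_actionE (take (size a) (g' (g a ++ b)))
              (drop (size a) (g' (g a ++ b))) gA.
    rewrite cat_take_drop g'K => /eqP; rewrite eqseq_cat.
      by case/andP=> /eqP/esym.
    by rewrite !(tree_aut_size _ gA) size_takel// sz' size_cat
      (tree_aut_size _ gA) leq_addr.
  exists l' => b.
    by rewrite /l' -local_actionE// gK drop_size_cat.
  have /eqP := local_actionE a (l' b) gA.
  by rewrite -l'E g'K eqseq_cat// eqxx => /eqP.
- by rewrite /local_action cats0 drop_oversize// tree_aut_size.
- move=> b c; rewrite -(adj_cat (g a)) -!local_actionE// gadj; exact: adj_cat.
Qed.

End Tree.

Notation cantor d := {ptws nat -> discrete_topology 'I_d}.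

Section Cantor.
Variable d : nat.
Implicit Types (a b : seq 'I_d) (g : seq 'I_d -> seq 'I_d) (p q : cantor d).

Definition cone a : set (cantor d) := [set p | mkseq p (size a) = a].

Definition prepend a p : cantor d := fun n => nth (p (n - size a)) a n.

Definition behead_word k p : cantor d := fun n => p (k + n).

(* The action of a tree automorphism on infinite words, characterised by
   mkseq_boundary: g maps each prefix of p to a prefix of the image of p. *)
Definition boundary g : cantor d -> cantor d :=
  fun p n => nth (p n) (g (mkseq p n.+1)) n.

Definition homeomorphism (h : cantor d -> cantor d) :=
  continuous h /\
  exists k : cantor d -> cantor d, [/\ continuous k, cancel h k & cancel k h].

(* The local action of h at a when h maps the cone of a onto the cone of b;
   b is determined by that cone as soon as d > 1. *)
Definition cone_action (h : cantor d -> cantor d) a b : cantor d -> cantor d :=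
  fun p => behead_word (size b) (h (prepend a p)).

Definition rover_nekrashevych (G : set (seq 'I_d -> seq 'I_d)) :
    set (cantor d -> cantor d) :=
  [set h | homeomorphism h /\
     forall p, exists a b, [/\ cone a p, h @` cone a = cone b &
       exists2 g, G g & cone_action h a b = boundary g]].

Lemma mkseq_boundary g p n : tree_aut g -> mkseq (boundary g p) n = g (mkseq p n).
Proof.
move=> gA; elim: n => [|n IHn]; first by have [_ ->] := gA.
rewrite !mkseqS {}IHn.
have [|y gy] := @tree_aut_child _ g (mkseq p n) (rcons (mkseq p n) (p n)) gA.
  by exists (p n).
rewrite gy /boundary mkseqS gy nth_rcons tree_aut_size// size_mkseq.
by rewrite ltnn eqxx.
Qed.

Lemma prepend_cone a p : cone a (prepend a p).
Proof.
apply: (@eq_from_nth _ (p 0)); rewrite size_mkseq// => i ia.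
by rewrite nth_mkseq// /prepend (set_nth_default (p 0)).
Qed.

Lemma prepend_behead a p : cone a p -> prepend a (behead_word (size a) p) = p.
Proof.
move=> pa; apply: funext => n; rewrite /prepend /behead_word.
have [na|an] := ltnP n (size a); last by rewrite nth_default// subnKC.
set x := p _; transitivity (nth x (mkseq p (size a)) n); first by rewrite pa.
by rewrite nth_mkseq.
Qed.

Lemma cone_actionE h a b p : h @` cone a = cone b ->
  h (prepend a p) = prepend b (cone_action h a b p).
Proof.
move=> hab; rewrite prepend_behead// -hab.
by exists (prepend a p) => //; exact: prepend_cone.
Qed.

End Cantor.

(* Main.v *)
(* V_dG is highly transitive on S, up to repetitions: if h in V_dG maps p to
   q <> p, take a cone U around p so small that h U is disjoint from U and that
   both avoid a given finite set of other points. The involution equal to h on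
   U, to h^-1 on h U and to the identity elsewhere lies in V_dG, moves p to q
   and fixes the finite set, so a tuple can be moved onto another one coordinate
   by coordinate as soon as both have the same equalities between coordinates.
   No counting of the cones in a partition (modulo d - 1) is needed. *)
Require Import Defs.
From mathcomp Require Import all_boot.
From mathcomp Require Import boolp classical_sets functions cardinality topology.

Set Implicit Arguments.
Unset Strict Implicit.
Unset Printing Implicit Defensive.
Local Open Scope classical_set_scope.

(** * Words, cones and boundary maps *)

Section Words.
Variable d : nat.
Implicit Types (a b c : seq 'I_d) (p q r u w : cantor d).

Lemma nbhs_cone p n : \forall u \near p, mkseq u n = mkseq p n.
Proof.
have pF := nbhs_filter p.
elim: n => [|n IHn]; first exact: filterE.
have pn : \forall u \near p, u n = p n.
  have /(_ [set p n]) := @proj_continuous nat (fun=> discrete_topology 'I_d) n p.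
  by apply; apply: discrete_set1.
by move: IHn pn; apply: (@filterS2 _ _ pF) => u; rewrite !mkseqS => -> ->.
Qed.

Lemma eq_mkseq_leq p q m n :
  (m <= n)%N -> mkseq p n = mkseq q n -> mkseq p m = mkseq q m.
Proof.
by move=> mn /(congr1 (take m)); rewrite /mkseq -!map_take !take_iota (minn_idPl mn).
Qed.

(** Two distinct words differ at some index, hence in all longer prefixes; [N] is a maximum over the
    finitely many pairs from [s]. *)
Lemma separating_length (s : seq (cantor d)) :
  exists N, {in s &, forall p q, mkseq p N = mkseq q N -> p = q}.
Proof.
have sep2 p q : exists n, forall m, (n <= m)%N -> mkseq p m = mkseq q m -> p = q.
  have [->|/eqP pq] := pselect (p = q); first by exists 0.
  have [n pqn] : exists n, p n <> q n.
    by apply/existsNP => pqE; move/eqP: pq; apply; apply: funext.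
  by exists n.+1 => m nm /(eq_mkseq_leq nm); rewrite !mkseqS => /rcons_inj[].
have [n nP] := choice (fun pq : cantor d * cantor d => sep2 pq.1 pq.2).
exists (\max_(pq <- allpairs pair s s) n pq) => p q ps qs; apply: (nP (p, q)).
by rewrite (@leq_bigmax_seq _ _ xpredT n (p, q))// allpairs_f.
Qed.

Lemma prepend_cat a c w : prepend (a ++ c) w = prepend a (prepend c w).
Proof.
apply: funext => n; rewrite /prepend nth_cat size_cat.
case: ltnP => an; first exact: set_nth_default.
by rewrite [RHS]nth_default// subnDA.
Qed.

Lemma behead_prepend a w : behead_word (size a) (prepend a w) = w.
Proof.
apply: funext => n; rewrite /behead_word /prepend nth_default ?leq_addr//.
by rewrite addKn.
Qed.

Lemma cone_eq p a b : cone a p -> cone b p -> size a = size b -> a = b.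
Proof. by rewrite /cone /= => <- <-; rewrite !size_mkseq => ->. Qed.

Lemma cone_prepend_mkseq a w n :
  cone (a ++ mkseq w n) (prepend a w).
Proof.
have wn : prepend (mkseq w n) (behead_word n w) = w.
  rewrite -[X in behead_word X](size_mkseq w n); apply: prepend_behead.
  by rewrite /cone /= size_mkseq.
by rewrite -{2}wn -prepend_cat; apply: prepend_cone.
Qed.

Lemma eq_prefix p q : (forall n, mkseq p n = mkseq q n) -> p = q.
Proof.
by move=> pq; apply: funext => n; move: (pq n.+1); rewrite !mkseqS => /rcons_inj[].
Qed.

Lemma boundary_id : boundary (@id (seq 'I_d)) = id.
Proof. by apply: funext => p; apply: funext => n; rewrite /boundary nth_mkseq. Qed.

Lemma boundary_comp g g' : tree_aut g -> tree_aut g' -> tree_aut (g' \o g) ->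
  boundary (g' \o g) = boundary g' \o @boundary d g.
Proof.
move=> gA g'A g'gA; apply: funext => p; apply: eq_prefix => n.
by rewrite /= !mkseq_boundary.
Qed.

(** The counterpart of [local_actionE] on infinite words, used to restrict a germ to a smaller
    cone. *)
Lemma boundary_prepend g c w : tree_aut g ->
  boundary g (prepend c w) = prepend (g c) (boundary (local_action g c) w).
Proof.
move=> gA; have cE v : mkseq (prepend c v) (size c) = c by exact: prepend_cone.
have gc : cone (g c) (boundary g (prepend c w)).
  by rewrite /cone /= tree_aut_size// mkseq_boundary// cE.
rewrite -(prepend_behead gc); congr prepend; apply: eq_prefix => n.
rewrite (mkseq_boundary _ _ (local_action_aut c gA)) /local_action.
have -> : c ++ mkseq w n = mkseq (prepend c w) (size c + n).
  have := cone_prepend_mkseq c w n.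
  by rewrite /cone /= size_cat size_mkseq.
rewrite -mkseq_boundary// tree_aut_size//.
by rewrite /mkseq -map_drop drop_iota add0n addKn -[size c in RHS]addn0 iotaDl -map_comp.
Qed.

End Words.

(** * Germs and the group laws of [V_dG] *)

Section RoverNekrashevych.
Variables (d : nat) (G : set (seq 'I_d -> seq 'I_d)).
Hypotheses (G_aut : G `<=` @tree_aut d) (G_group : perm_group G).
Hypothesis G_ss : self_similar G.
Implicit Types (a b c : seq 'I_d) (p q r u w : cantor d).
Implicit Types (f h k : cantor d -> cantor d).

Local Notation V := (rover_nekrashevych G).

(* This is the local condition of V_dG on the cone of a, without the requirement
   that h maps that cone onto the cone of b: see V_homeo. *)
Definition germ h a b g := G g /\ forall w, h (prepend a w) = prepend b (boundary g w).

(** Self-similarity keeps the label in [G] when a germ is restricted to a subcone. *)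
Lemma germ_cat h a b g c :
  germ h a b g -> germ h (a ++ c) (b ++ g c) (local_action g c).
Proof.
move=> [Gg hE]; split=> [|w]; first exact: G_ss.
by rewrite !prepend_cat hE boundary_prepend//; exact: G_aut.
Qed.

Lemma germ_inv h k a b g : cancel h k ->
  germ h a b g -> exists2 g', G g' & germ k b a g'.
Proof.
move=> hK [Gg hE]; have [Gbij Gid Gcomp Ginv] := G_group.
have [g' gK g'K] := Gbij _ Gg; have Gg' := Ginv _ _ Gg gK g'K.
exists g' => //; split=> // w.
have gg' : g \o g' = id by apply: funext.
(* The right side becomes [k] of its image under [h], where [boundary g] cancels [boundary g']. *)
rewrite -[RHS]hK hE; congr (k (prepend b _)).
by rewrite -[RHS]/((boundary g \o boundary g') w) -boundary_comp ?gg' ?boundary_id//;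
  apply: G_aut.
Qed.

Lemma germ_comp h h' a b c g g' : germ h a b g -> germ h' b c g' ->
  germ (h' \o h) a c (g' \o g).
Proof.
move=> [Gg hE] [Gg' h'E]; have [_ _ Gcomp _] := G_group.
split=> [|w]; first exact: Gcomp.
by rewrite /= hE h'E boundary_comp//; apply: G_aut => //; exact: Gcomp.
Qed.

Lemma V_germ h p : V h -> exists a b g, cone a p /\ germ h a b g.
Proof.
move=> [_ /(_ p)[a [b [pa hab [g Gg gE]]]]].
exists a, b, g; split=> //; split=> // w.
by rewrite (cone_actionE _ hab) gE.
Qed.

(** By [germ_inv] the inverse of [h] sends the cone of [b] into that of [a], so [h] maps the latter
    onto the former. *)
Lemma V_homeo h : homeomorphism h ->
  (forall p, exists a b g, cone a p /\ germ h a b g) -> V h.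
Proof.
move=> hh hg; split=> // p; have [a [b [g [pa hE]]]] := hg p.
exists a, b; split=> //; last first.
  exists g; first by case: hE.
  by apply: funext => w; rewrite /cone_action (hE.2 w) behead_prepend.
have [_ [k [_ hK kK]]] := hh.
have [g' _ kE] := germ_inv hK hE.
apply/seteqP; split=> [_ [u ua <-]|u ub].
  by rewrite -(prepend_behead ua) hE.2; exact: prepend_cone.
exists (k u) => //.
by rewrite -(prepend_behead ub) kE.2; exact: prepend_cone.
Qed.

(** Extending [a] by [c] extends [b] by [g c], of the same length since tree automorphisms preserve
    levels. *)
Lemma V_germ_deep h p n : V h -> exists a b g,
  [/\ cone a p, germ h a b g, (n <= size a)%N & (n <= size b)%N].
Proof.
move=> /(V_germ p)[a [b [g [pa hE]]]].
pose c := mkseq (behead_word (size a) p) n.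
exists (a ++ c), (b ++ g c), (local_action g c); split.
- by rewrite -[X in cone _ X](prepend_behead pa); exact: cone_prepend_mkseq.
- exact: germ_cat.
- by rewrite size_cat size_mkseq leq_addl.
- by rewrite size_cat tree_aut_size ?size_mkseq ?leq_addl//; apply: G_aut; case: hE.
Qed.

Lemma V_modulus h p N : V h ->
  exists m, forall u, mkseq u m = mkseq p m -> mkseq (h u) N = mkseq (h p) N.
Proof.
move=> /(V_germ_deep p N)[a [b [g [pa hE _ Nb]]]]; exists (size a) => u up.
have ua : cone a u by rewrite /cone /= up.
apply: (eq_mkseq_leq Nb).
rewrite -(prepend_behead ua) -(prepend_behead pa) !hE.2.
by rewrite !(prepend_cone _ _ : mkseq _ _ = _).
Qed.

Lemma V_id : V id.
Proof.
have id_cont : continuous (@id (cantor d)) by move=> p; exact: cvg_id.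
apply: V_homeo; first by split=> //; exists id; split.
move=> p; exists [::], [::], id; split=> //; have [_ Gid _ _] := G_group.
by split=> // w; rewrite boundary_id.
Qed.

Lemma V_comp f h : V f -> V h -> V (f \o h).
Proof.
move=> Vf Vh; apply: V_homeo.
  have [[fc [f' [f'c fK f'K]]] _] := Vf; have [[hc [h' [h'c hK h'K]]] _] := Vh.
  split; first by move=> p; apply: continuous_comp; [exact: hc|exact: fc].
  exists (h' \o f'); split; [|exact: can_comp|exact: can_comp].
  by move=> p; apply: continuous_comp; [exact: f'c|exact: h'c].
move=> p; have [a [b [g [pa hE]]]] := V_germ p Vh.
have [a' [b' [g' [pa' fE]]]] := V_germ (h p) Vf.
(* Both [b] and [a'] are prefixes of [h p]. Extending each by the length of the other gives prefixes
   of equal length, so the refined germs compose. *)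
pose c := mkseq (behead_word (size a) p) (size a').
pose c' := mkseq (behead_word (size a') (h p)) (size b).
have gA : tree_aut g by apply: G_aut; case: hE.
have pc : cone (a ++ c) p.
  by rewrite -[X in cone _ X](prepend_behead pa); exact: cone_prepend_mkseq.
have hpc' : cone (a' ++ c') (h p).
  by rewrite -[X in cone _ X](prepend_behead pa'); exact: cone_prepend_mkseq.
have hE' := germ_cat c hE.
have hpc : cone (b ++ g c) (h p).
  by rewrite -[p](prepend_behead pc) (proj2 hE'); exact: prepend_cone.
have bE : b ++ g c = a' ++ c'.
  by apply: cone_eq hpc hpc' _; rewrite !size_cat tree_aut_size// !size_mkseq addnC.
rewrite bE in hE'.
by do 3 eexists; split; [exact: pc|exact: germ_comp hE' (germ_cat c' fE)].
Qed.

Lemma V_inv h k : V h -> cancel h k -> cancel k h -> V k.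
Proof.
move=> Vh hK kK; have [[hc [k' [k'c hK' k'K]]] _] := Vh.
have kE : k' = k by apply: funext => p; rewrite -{1}[p]kK hK'.
apply: V_homeo; first by split; [rewrite -kE|exists h; split].
move=> q; have [a [b [g [qa hE]]]] := V_germ (k q) Vh.
have [g' _ kE'] := germ_inv hK hE.
exists b, a, g'; split=> //.
by rewrite -[q]kK -(prepend_behead qa) hE.2; exact: prepend_cone.
Qed.

(** * Gluing, and swapping two points *)

Lemma V_glue f : involutive f ->
  (forall r, exists2 h, V h &
    exists n, forall u, mkseq u n = mkseq r n -> f u = h u) -> V f.
Proof.
move=> fK floc; apply: V_homeo.
  have fc : continuous f.
    move=> r; have [h Vh [n fh]] := floc r; have [[hc _] _] := Vh.
    have fhr : \forall u \near r, h u = f u.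
      by move: (nbhs_cone r n); apply: (@filterS _ _ (nbhs_filter r)) => u /fh.
    rewrite /continuous_at (fh r)//; apply: cvg_trans (hc r).
    exact: (@near_eq_cvg _ _ _ (nbhs_filter r)).
  by split=> //; exists f; split.
move=> r; have [h Vh [n fh]] := floc r.
have [a [b [g [ra [Gg hE] na _]]]] := V_germ_deep r n Vh.
exists a, b, g; split=> //; split=> // w.
rewrite fh ?hE//; apply: eq_mkseq_leq na _.
by rewrite (prepend_cone a w : mkseq _ _ = _) (ra : mkseq _ _ = _).
Qed.

Lemma V_swap h p (s : seq (cantor d)) : V h -> exists2 f, V f &
  f p = h p /\ {in s, forall r, r <> p -> r <> h p -> f r = r}.
Proof.
move=> Vh; have [hpp|hpp] := pselect (h p = p); first by exists id; [exact: V_id|].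
have [[_ [k [_ hK kK]]] _] := Vh; have Vk := V_inv Vh hK kK.
have [N sepN] := separating_length (p :: h p :: s).
have [m0 m0P] := V_modulus p N Vh.
(* [U] is a cone around [p], and [U (k r)] says that [r] lies in its image under [h]. By [m0], that
   image lies in the cone of length [N] at [h p]; by [N <= m], [U] lies in the one at [p]. *)
pose m := maxn m0 N; pose U r := mkseq r m == mkseq p m.
have UN r : U r -> mkseq r N = mkseq p N.
  by move=> /eqP; exact: eq_mkseq_leq (leq_maxr _ _).
have UhN r : U (k r) -> mkseq r N = mkseq (h p) N.
  by move=> /eqP /(eq_mkseq_leq (leq_maxl _ _))/m0P; rewrite kK.
have UkF r : U r -> U (k r) -> False.
  move=> /UN rp /UhN; rewrite rp => /sepN e; apply/hpp/esym/e; by rewrite !inE eqxx ?orbT.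
pose f r := if U r then h r else if U (k r) then k r else r.
have Up : U p by exact: eqxx.
exists f; last first.
  split=> [|r rs rp rq]; first by rewrite /f Up.
  rewrite /f; case: ifPn => [/UN/sepN e|_].
    by case: rp; apply: e; rewrite !inE ?eqxx ?rs ?orbT.
  case: ifPn => [/UhN/sepN e|//].
  by case: rq; apply: e; rewrite !inE ?eqxx ?rs ?orbT.
apply: V_glue => [r|r].
  rewrite {2}/f; case: ifPn => [Ur|nUr].
    rewrite /f hK Ur; case: ifPn => // Uhr.
    by have := UkF _ Uhr; rewrite hK => /(_ Ur).
  by case: ifPn => [Ukr|nUkr]; rewrite /f ?Ukr ?kK// (negbTE nUr) (negbTE nUkr).
(* Near [r] the tests [U u] and [U (k u)] are constant, so a single branch of [f] applies. *)
have [n nP] := V_modulus r m Vk.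
exists (if U r then h else if U (k r) then k else id).
  by case: ifP => // _; case: ifP => // _; exact: V_id.
exists (maxn m n) => u ur.
have -> : U r = U u by rewrite /U (eq_mkseq_leq (leq_maxl _ _) ur).
have -> : U (k r) = U (k u).
  by rewrite /U (nP u)//; exact: eq_mkseq_leq (leq_maxr _ _) ur.
by rewrite /f; case: ifP => // _; case: ifP.
Qed.

(** * High transitivity on an orbit *)

Lemma V_orbit_trans p0 p q :
  orbit_of V p0 p -> orbit_of V p0 q -> exists2 h, V h & h p = q.
Proof.
move=> [f Vf <-] [h Vh <-]; have [[_ [f' [_ fK f'K]]] _] := Vf.
by exists (h \o f'); [exact: V_comp (V_inv Vf fK f'K)|rewrite /= fK].
Qed.

Lemma V_highly_transitive p0 n (t t' : 'I_n -> cantor d) :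
  (forall i, orbit_of V p0 (t i)) -> (forall i, orbit_of V p0 (t' i)) ->
  (forall i j, t i = t j <-> t' i = t' j) -> exists2 f, V f & f \o t = t'.
Proof.
move=> tS t'S tt'.
(* Induction on the number [m] of coordinates already in place. *)
suff /(_ n (leqnn n))[f Vf ft] : forall m, (m <= n)%N ->
    exists2 f, V f & forall i : 'I_n, (i < m)%N -> f (t i) = t' i.
  by exists f => //; apply: funext => i; exact: ft.
elim=> [|m IHm] mn; first by exists id => [|i]; [exact: V_id|rewrite ltn0].
have [f Vf ft] := IHm (ltnW mn).
have finj : injective f by have [[_ [f' [_ fK _]]] _] := Vf; exact: can_inj fK.
pose im := Ordinal mn.
have lt_im (i : 'I_n) : (i < m.+1)%N -> (i < m)%N \/ i = im.
  by rewrite ltnS leq_eqVlt => /orP[/eqP e|]; [right; apply: val_inj|left].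
(* A repeated coordinate is already in place, as [t'] has the same equalities. *)
have [[j jm tj]|old] := pselect (exists2 j : 'I_n, (j < m)%N & t j = t im).
  exists f => // i /lt_im[|->]; first exact: ft.
  by rewrite -tj ft//; apply/tt'.
have ftS : orbit_of V p0 (f (t im)).
  by have [h Vh <-] := tS im; exists (f \o h) => //; exact: V_comp.
have [h Vh hE] := V_orbit_trans ftS (t'S im).
have [g Vg [gim gfix]] := V_swap (f (t im)) [seq t' i | i : 'I_n] Vh.
exists (g \o f); first exact: V_comp.
move=> i /lt_im[im'|->] /=; last by rewrite gim.
(* The swap fixes each placed [t' i]: it differs from [f (t im)] by injectivity of [f], and from
   [t' im] by the common pattern. *)
rewrite ft// gfix ?hE//.
- by apply/mapP; exists i; rewrite ?mem_enum.
- by rewrite -ft// => /finj e; apply: old; exists i.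
- by move=> /tt' e; apply: old; exists i.
Qed.

End RoverNekrashevych.

(** * Finitely many equality patterns *)

Theorem proposition3 (d : nat) (hd : (2 <= d)%N)
    (G : set (seq 'I_d -> seq 'I_d))
    (G_aut : subset G (@tree_aut d)) (G_group : perm_group G)
    (G_ss : self_similar G)
    (S : set (cantor d))
    (S_orbit : exists p, S = orbit_of (rover_nekrashevych G) p) :
  oligomorphic (rover_nekrashevych G) S.
Proof.
have [p ->] := S_orbit => n _; set V := rover_nekrashevych G.
set D := [set t | _].
pose pat (t : 'I_n -> cantor d) := [ffun ij : 'I_n * 'I_n => `[< t ij.1 = t ij.2 >]].
have patP t t' : pat t = pat t' -> forall i j, t i = t j <-> t' i = t' j.
  move=> /ffunP e i j; have := e (i, j); rewrite !ffunE /= => {}e.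
  by split=> /asboolP; [rewrite e|rewrite -e] => /asboolP.
have sub t t' : D t -> D t' -> pat t = pat t' -> diag_orbit V t' `<=` diag_orbit V t.
  move=> Dt Dt' /patP tt' _ [f Vf <-].
  have [h Vh <-] := V_highly_transitive G_aut G_group G_ss Dt Dt' tt'.
  by exists (f \o h) => //; exact: V_comp.
have [rep repP] : exists rep, forall t, D t -> diag_orbit V t = rep (pat t).
  (* The union of all orbits with pattern [e] is a single orbit or empty, so no representative has
     to be chosen. *)
  pose rep e := [set u | exists2 t, D t /\ pat t = e & diag_orbit V t u].
  exists rep => t Dt; apply/seteqP; split=> [u ut|u [t' [Dt' e] ut']].
    by exists t.
  exact: sub ut'.
apply: (@sub_finite_set _ _ (rep @` setT)); last exact/finite_image/finite_finset.
by move=> _ [t Dt <-]; exists (pat t) => //; rewrite repP.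
Qed.
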